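(* Let $T>0$, let $\Omega\subset\mathbb{R}^N$ be a nonempty open set, and let $f=f(t,x)\colon [0,T]\times\Omega\to\mathbb{R}^N$ be continuous. Let $(V_{u})_{u\in \partial G}$ be a family of non-degenerate bounding functions for a nonempty open bounded set $G$ with $\overline{G}\subset\Omega$ and with $\overline{G}$ strictly star-shaped with respect to all the points in a ball $B[p,\delta]\subset G$ (with $\delta>0$). Assume that $$\langle f(t,u), \nabla V_{u}(u)\rangle \leq 0, \quad \text{for all } u\in \partial G \text{ and } t\in [0,T].$$ Then there exists a $T$-periodic solution of $\dot{y}=f(t,y)$ with values in $\overline{G}$.
   Context: $\langle\cdot,\cdot\rangle$ and $\|\cdot\|$ are the Euclidean inner product and norm; $B(u,r)$ and $B[u,r]$ are the open and closed balls with center $u$ and radius $r$. A family of bounding functions for an open bounded set $G$ is a family $(V_u)_{u\in\partial G}$ such that for each $u\in\partial G$ there is a radius $r_u>0$ for which $V_u\colon B(u,r_u)\to\mathbb{R}$ is a $\mathcal{C}^1$-function with $V_u(u)=0$ and $G\cap B(u,r_u)\subset\{x\in B(u,r_u)\colon V_u(x)<0\}$. The family is called non-degenerate if there are constants $0<\eta^-\leq\eta^+$ such that $\eta^-\leq\|\nabla V_u(u)\|\leq\eta^+$ for all $u\in\partial G$. For a nonempty open bounded set $A\subset\mathbb{R}^N$, $\overline{A}$ is strictly star-shaped with respect to a point $p\in A$ if for each $u\in\partial A$ one has $[p,u[\,\subset A$, where $[p,u[\,:=\{p+\vartheta(u-p)\colon 0\leq\vartheta<1\}$. A $T$-periodic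 solution of $\dot y=f(t,y)$ with values in $\overline{G}$ is a solution $y$ defined on $[0,T]$ such that $y(0)=y(T)$ and $y(t)\in\overline{G}$ for all $t\in[0,T]$. Uniqueness of solutions of initial value problems is not assumed. *)

(* Defs.v *)
From HB Require Import structures.
From mathcomp Require Import all_boot all_order all_algebra.
From mathcomp Require Import all_classical all_reals all_analysis.
Set Implicit Arguments.
Unset Strict Implicit.
Unset Printing Implicit Defensive.
Import Order.TTheory GRing.Theory Num.Theory.
Import numFieldNormedType.Exports.
Local Open Scope classical_set_scope.
Local Open Scope ring_scope.

(* The library norm on 'rV[R]_N is the sup norm; the Euclidean structure is
   defined here. Both induce the same topology and the same bounded sets, so
   open, closure, bounded_set and the limits below are the library ones. *)
Definition dotv (R : realType) (N : nat) (x y : 'rV[R]_N) : R :=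
  \sum_(i < N) x 0 i * y 0 i.

Definition enorm (R : realType) (N : nat) (x : 'rV[R]_N) : R :=
  Num.sqrt (dotv x x).

Definition eball (R : realType) (N : nat) (u : 'rV[R]_N) (r : R) :
  set 'rV[R]_N := [set x | enorm (x - u) < r].

Definition eclosed_ball (R : realType) (N : nat) (u : 'rV[R]_N) (r : R) :
  set 'rV[R]_N := [set x | enorm (x - u) <= r].

Definition frontier (T : topologicalType) (A : set T) : set T :=
  closure A `\` interior A.

Definition gradient (R : realType) (N : nat) (V : 'rV[R]_N -> R)
  (x : 'rV[R]_N) : 'rV[R]_N := \row_(i < N) 'D_(delta_mx 0 i) V x.

(* V is a total function, but for D open this depends only on V on D. *)
Definition C1_on (R : realType) (N : nat) (D : set 'rV[R]_N)
    (V : 'rV[R]_N -> R) : Prop :=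
  (forall x, D x -> differentiable V x) /\ {within D, continuous (gradient V)}.

(* V u stands for a function on eball u r only; its values elsewhere, and V u
   for u outside the frontier of G, are irrelevant. *)
Definition bounding_functions (R : realType) (N : nat) (G : set 'rV[R]_N)
    (V : 'rV[R]_N -> 'rV[R]_N -> R) : Prop :=
  forall u, frontier G u -> exists r : R,
    [/\ 0 < r, C1_on (eball u r) (V u), V u u = 0 &
        G `&` eball u r `<=` [set x | eball u r x /\ V u x < 0]].

Definition non_degenerate (R : realType) (N : nat) (G : set 'rV[R]_N)
    (V : 'rV[R]_N -> 'rV[R]_N -> R) : Prop :=
  exists eta_m eta_p : R, [/\ 0 < eta_m, eta_m <= eta_p &
    forall u, frontier G u -> eta_m <= enorm (gradient (V u) u) <= eta_p].

(* The closure of the open set A is strictly star-shaped with respect to p. *)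
Definition strictly_star_shaped (R : realType) (N : nat) (A : set 'rV[R]_N)
    (p : 'rV[R]_N) : Prop :=
  A p /\ forall u, frontier A u ->
    [set p + theta *: (u - p) | theta in [set theta : R | 0 <= theta < 1]]
      `<=` A.

(* The derivative is taken relative to [0, T]: one-sided at the end points. *)
Definition is_solution (R : realType) (N : nat) (T : R)
    (f : R -> 'rV[R]_N -> 'rV[R]_N) (y : R -> 'rV[R]_N) : Prop :=
  forall t, 0 <= t <= T ->
    (s - t)^-1 *: (y s - y t) @[s --> within `[0, T] t^'] --> f t (y t).

Definition periodic_solution_in (R : realType) (N : nat) (T : R)
    (f : R -> 'rV[R]_N -> 'rV[R]_N) (K : set 'rV[R]_N)
    (y : R -> 'rV[R]_N) : Prop :=
  [/\ is_solution T f y, y 0 = y T & forall t, 0 <= t <= T -> K (y t)].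

(* Main.v *)
(* Put f_l(t, x) = l f(t, x) - ((1 - l) / T) (x - p) for 0 <= l <= 1. Star-shapedness with
   respect to a whole ball gives <u - p, grad V_u(u)> > 0 on the frontier, so for l < 1 the field
   f_l points strictly inwards there, and no T-periodic solution of y' = f_l(t, y) with values in
   the closure of G can touch the frontier: V_u(y(s)) <= 0 = V_u(u) just before the time of contact
   (a contact at time 0 is also one at time T) contradicts the sign of the left derivative.

   It remains to find some l and a T-periodic solution of y' = f_l(t, y) in the closure of G which,
   if l < 1, touches the frontier; then l = 1 and f_1 = f. For a cyclic Euler scheme with n nodes,
   let l depend continuously on the vector of nodes: l = 0 as soon as some node leaves G, and l = 1
   when all nodes are at distance at least 1/n from the complement of G. Brouwer's theorem, applied
   to the vector of all nodes, gives a cyclic Euler polygon inside G for which l < 1 only if some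
   node is within 1/n of the complement. Limits along an ultrafilter on n give y and l.

   Brouwer's theorem is obtained on the grid {0, ..., n}^m from a cup product: if the Boolean label
   a_i is 0 on the face x_i = 0 and 1 on the face x_i = n, then the sum of da_1 u ... u da_m over
   all unit cubes is 1 mod 2 by Stokes, hence in some unit cube all labels change. *)

Require Import Defs.
From HB Require Import structures.
From mathcomp Require Import all_boot all_order all_algebra.
From mathcomp Require Import all_classical all_reals all_analysis.
From mathcomp Require Import ring lra.
Set Implicit Arguments.
Unset Strict Implicit.
Unset Printing Implicit Defensive.
Import Order.TTheory GRing.Theory Num.Theory.
Import numFieldNormedType.Exports.
Local Open Scope classical_set_scope.
Local Open Scope ring_scope.

(** * Labellings of a grid *)

Section GridLabelling.
Variable I : eqType.
Implicit Types (c x y : I -> nat) (D s : seq I).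

Definition upd c k j : I -> nat := fun i => if i == k then j else c i.
Definition step k c := upd c k (c k).+1.
Definition others k D := [seq l <- D | l != k].

Lemma updC c k l i j : k != l -> upd (upd c k i) l j = upd (upd c l j) k i.
Proof.
move=> kl; apply/funext => x; rewrite /upd.
by case: eqP => // ->; rewrite eq_sym (negbTE kl).
Qed.

Lemma stepC k l c : step k (step l c) = step l (step k c).
Proof.
apply/funext => x; rewrite /step /upd.
have [->//|kl] := eqVneq k l.
by case: (eqVneq x k) => [->|_]; rewrite ?(negbTE kl).
Qed.

Lemma step_upd k c j : step k (upd c k j) = upd c k j.+1.
Proof. by apply/funext => x; rewrite /step /upd eqxx; case: eqP. Qed.

Lemma step_upd_neq k l c j : k != l -> step k (upd c l j) = upd (step k c) l j.
Proof. by move=> kl; rewrite /step /upd (negbTE kl) -/(upd _ _ _) updC// eq_sym. Qed.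

Lemma othersC k l D : others k (others l D) = others l (others k D).
Proof. by rewrite /others -!filter_predI; apply: eq_filter => x /=; rewrite andbC. Qed.

Lemma add_F2 (x : 'F_2) : x + x = 0.
Proof. by rewrite addrr_pchar2 ?pchar_Fp. Qed.

Lemma sum_telescope_F2 n (S : nat -> 'F_2) : \sum_(j < n) (S j.+1 + S j) = S n + S 0%N.
Proof.
elim: n => [|n IH]; first by rewrite big_ord0 add_F2.
by rewrite big_ord_recr /= IH addrC -addrA (addrA (S n)) add_F2 add0r.
Qed.

(** The diagonal is left out by [others], and the terms at [(k, l)] and [(l, k)] cancel mod 2. *)
Lemma sum_sym_F2 D (H : I -> I -> 'F_2) : (forall k l, H k l = H l k) ->
  \sum_(k <- D) \sum_(l <- others k D) H k l = 0.
Proof.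
move=> Hs; under eq_bigr do rewrite big_filter.
elim: D => [|z D IH]; first by rewrite big_nil.
rewrite big_cons big_cons eqxx /=.
have e k : \sum_(l <- z :: D | l != k) H k l =
    (if k != z then H z k else 0) + \sum_(l <- D | l != k) H k l.
  by rewrite big_cons eq_sym Hs; case: (k == z); rewrite ?add0r.
by under [X in _ + X]eq_bigr do rewrite e; rewrite big_split /= IH addr0 -big_mkcond add_F2.
Qed.

Variable a : I -> (I -> nat) -> bool.
Let A i c : 'F_2 := (a i c)%:R.

(* The cup product of the coboundaries of the labels [a i], [i] in [s], summed over the Kuhn
   triangulation of the cube with lowest vertex [c] and edge directions [D]. *)
Fixpoint cup s D c : 'F_2 :=
  if s is i :: s' then
    \sum_(k <- D) (A i (step k c) + A i c) * cup s' (others k D) (step k c)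
  else 1.

(** Leibniz rule: [A i c] times the coboundary of [cup s] vanishes by hypothesis, and adding it
    turns the product of [dA i] with [cup s] into the coboundary of [A i] times [cup s]. *)
Lemma cup_exact_of_closed i s D c :
  \sum_(k <- D) (cup s (others k D) (step k c) + cup s (others k D) c) = 0 ->
  cup (i :: s) D c = \sum_(k <- D) (A i (step k c) * cup s (others k D) (step k c)
     + A i c * cup s (others k D) c).
Proof.
move=> cl; have := congr1 ( *%R (A i c)) cl; rewrite mulr0 => e.
rewrite -[RHS]addr0 -[X in _ = _ + X]e mulr_sumr -big_split.
apply: eq_bigr => k _ /=; rewrite mulrDl mulrDr -!addrA; congr (_ + _).
by rewrite [_ + A i c * cup _ _ c]addrC addrA add_F2 add0r.
Qed.

(* Once [cup (i :: s)] is written as a coboundary, its own coboundary is a sum symmetric in two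
   directions, which vanishes mod 2. *)
Lemma cup_closed s D c :
  \sum_(k <- D) (cup s (others k D) (step k c) + cup s (others k D) c) = 0.
Proof.
elim: s D c => [|i s IH] D c; first by apply: big1 => k _; rewrite add_F2.
pose P k l x := A i x * cup s (others l (others k D)) x.
rewrite -[RHS](@sum_sym_F2 D (fun k l => P k l (step l (step k c)) +
   (P k l (step k c) + P k l (step l c)) + P k l c)).
  apply: eq_bigr => k _; rewrite !cup_exact_of_closed ?IH// -big_split /=.
  by apply: eq_bigr => l _; rewrite /P stepC !addrA.
by move=> k l; rewrite /P othersC stepC [X in _ + X + _]addrC.
Qed.

Lemma cup_exact i s D c : cup (i :: s) D c =
  \sum_(k <- D) (A i (step k c) * cup s (others k D) (step k c)
     + A i c * cup s (others k D) c).
Proof. by apply: cup_exact_of_closed; apply: cup_closed. Qed.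

Definition in_cube D c x := forall j, (c j <= x j <= c j + (j \in D))%N.

(** A nonzero sum has a nonzero term, that is, an edge path starting at [c] on which the labels of
    [s] change one after the other; the ends of the edge belonging to [i] carry both values of
    [a i]. *)
Lemma cup_neq0 s D c : cup s D c != 0 ->
  forall i b, i \in s -> exists2 x, in_cube D c x & a i x = b.
Proof.
elim: s D c => [//|j s IH] D c.
case: (boolP (has (fun k => (A j (step k c) + A j c) *
    cup s (others k D) (step k c) != 0) D)); last first.
  rewrite -all_predC => /allP h /negP; case; rewrite /= big_seq big1// => k kD.
  by apply/eqP; have := h _ kD; rewrite /= negbK.
move=> /hasP[k kD]; rewrite mulf_eq0 negb_or => /andP[Ak /IH {}IH] _ i b.
have sc : in_cube D c (step k c).
  move=> l; rewrite /step /upd; case: eqP => [->|_]; last by rewrite leqnn leq_addr.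
  by rewrite kD addn1 leqnSn leqnn.
have ck : in_cube D c c by move=> l; rewrite leqnn leq_addr.
rewrite inE; case: eqVneq => [-> _|_ /= /(IH _ b)[x xc <-]]; last first.
  exists x => // l; move: (xc l) (sc l); rewrite mem_filter /step /upd.
  case: (eqVneq l k) => [->|_] /=; last by [].
  by rewrite addn0 -eqn_leq => /eqP <-.
case: (a j c =P b) => [<-|jb]; first by exists c.
exists (step k c) => //; move: Ak jb; rewrite /A.
by case: (a j c) (a j _) b => -[] [] //; rewrite ?add_F2 ?addr0 ?eqxx.
Qed.

Fixpoint box_sum n D (F : (I -> nat) -> 'F_2) c : 'F_2 :=
  if D is k :: D' then \sum_(j < n) box_sum n D' F (upd c k j) else F c.

Lemma eq_box_sum n D (F H : (I -> nat) -> 'F_2) c :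
  (forall x, {in predC (mem D), x =1 c} -> F x = H x) ->
  box_sum n D F c = box_sum n D H c.
Proof.
elim: D c => [|k D IH] c FH /=; first by apply: FH.
apply: eq_bigr => j _; apply: IH => x xc; apply: FH => i.
rewrite !inE negb_or => /andP[ik iD]; rewrite xc ?inE// /upd (negbTE ik) //.
Qed.

Lemma box_sum_others n D F c k : uniq D -> k \in D ->
  box_sum n D F c = \sum_(j < n) box_sum n (others k D) F (upd c k j).
Proof.
elim: D c => [//|l D IH] c /= /andP[lD uD]; rewrite inE.
case: eqVneq => [-> _|kl /= kD].
  apply: eq_bigr => j _; congr box_sum;
  by apply/esym/all_filterP/allP => x xD; apply: contraNneq lD => <-.
under eq_bigr do rewrite IH//.
rewrite exchange_big /=; apply: eq_bigr => i _; apply: eq_bigr => j _.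
by rewrite updC // eq_sym.
Qed.

Lemma box_sumD n D F H c :
  box_sum n D (fun x => F x + H x) c = box_sum n D F c + box_sum n D H c.
Proof.
elim: D c => [//|k D IH] c /=; under eq_bigr do rewrite IH.
by rewrite big_split.
Qed.

Lemma box_sum0 n D c : box_sum n D (fun=> 0) c = 0.
Proof. by elim: D c => [//|k D IH] c /=; rewrite big1. Qed.

Lemma box_sum_sum n D r (F : I -> (I -> nat) -> 'F_2) c :
  box_sum n D (fun x => \sum_(k <- r) F k x) c = \sum_(k <- r) box_sum n D (F k) c.
Proof.
elim: r => [|k r IH].
  by rewrite big_nil -[RHS](@box_sum0 n D c); apply: eq_box_sum => x _; rewrite big_nil.
rewrite big_cons -IH -box_sumD; apply: eq_box_sum => x _; exact: big_cons.
Qed.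

Lemma box_sum_step n D F k c : k \notin D ->
  box_sum n D (F \o step k) c = box_sum n D F (step k c).
Proof.
elim: D c => [//|l D IH] c; rewrite inE negb_or => /andP[kl kD] /=.
by apply: eq_bigr => j _; rewrite IH// step_upd_neq.
Qed.

(** Stokes in one direction: the sum along [k] telescopes to the faces [x k = n] and [x k = 0]. *)
Lemma box_sum_telescope n D F k c : uniq D -> k \in D ->
  box_sum n D (fun x => F (step k x) + F x) c =
  box_sum n (others k D) F (upd c k n) + box_sum n (others k D) F (upd c k 0).
Proof.
move=> uD kD; rewrite (box_sum_others _ _ _ uD kD).
have kk : k \notin others k D by rewrite mem_filter eqxx.
under eq_bigr do rewrite box_sumD (box_sum_step _ F _ kk) step_upd.
exact: (sum_telescope_F2 n (fun j => box_sum n (others k D) F (upd c k j))).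
Qed.

Variable n : nat.
Hypothesis a0 : forall i x, x i = 0%N -> a i x = false.
Hypothesis an : forall i x, x i = n -> a i x = true.

(** On a face normal to [k] the label [a k] is constant, whereas a nonzero product would require
    both of its values. *)
Lemma cup_const s D c k : k \in s -> k \notin D -> c k = 0%N \/ c k = n ->
  cup s D c = 0.
Proof.
move=> ks kD ck; apply/eqP; apply: contraT => /cup_neq0 h.
have [x xc ax] := h _ true ks; have [y yc ay] := h _ false ks.
have e z : in_cube D c z -> z k = c k.
  by move=> /(_ k); rewrite (negbTE kD) addn0 -eqn_leq => /eqP.
case: ck => ck; first by rewrite a0 ?e in ax.
by rewrite an ?e in ay.
Qed.

(** Induction by Stokes: [cup (i :: s)] is the coboundary of [A i] times [cup s]. Faces normal to
    some [k] in [s] contribute 0 by [cup_const], the face [x i = 0] contributes 0 because [A i]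
    vanishes there, and on [x i = n] the factor [A i] is 1, which leaves the sum for [s]. *)
Lemma box_sum_cup s c : uniq s -> box_sum n s (cup s s) c = 1.
Proof.
elim: s c => [//|i s IH] c us.
have /= /andP[is_ us'] := us.
have oi : others i (i :: s) = s.
  rewrite /others /= eqxx /=; apply/all_filterP/allP => x xs.
  by apply: contraNneq is_ => <-.
pose F k x := A i x * cup s (others k (i :: s)) x.
transitivity (box_sum n (i :: s) (fun x => \sum_(k <- i :: s) (F k (step k x) + F k x)) c).
  apply: (@eq_box_sum n (i :: s) (cup (i :: s) (i :: s))) => x _.
  by rewrite cup_exact.
rewrite box_sum_sum big_cons big_seq big1 => [|k ks]; last first.
  rewrite (box_sum_telescope _ _ _ us) ?inE ?ks ?orbT//.
  have z m : m = 0%N \/ m = n -> box_sum n (others k (i :: s)) (F k) (upd c k m) = 0.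
    move=> mE; rewrite -[RHS](@box_sum0 n (others k (i :: s)) (upd c k m)).
    apply: eq_box_sum => x xc; rewrite /F (@cup_const _ _ _ k) ?mulr0//.
      by rewrite mem_filter eqxx.
    by rewrite xc ?inE ?mem_filter ?eqxx// /upd eqxx.
  by rewrite !z ?addr0; auto.
rewrite (box_sum_telescope _ _ _ us) ?mem_head// addr0 oi.
rewrite -[RHS]addr0; congr (_ + _); last first.
  rewrite -[RHS](@box_sum0 n s (upd c i 0)); apply: eq_box_sum => x xc.
  by rewrite /F /A a0 ?mul0r// xc ?inE// /upd eqxx.
rewrite -(IH (upd c i n) us'); apply: eq_box_sum => x xc.
by rewrite /F oi /A an ?mul1r// xc ?inE// /upd eqxx.
Qed.

Lemma box_sum_neq0 m D F c : box_sum m D F c != 0 ->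
  exists x, [/\ F x != 0, {in D, forall i, (x i < m)%N} & {in predC (mem D), x =1 c}].
Proof.
elim: D c => [|k D IH] c /=; first by exists c.
case: (boolP [exists j : 'I_m, box_sum m D F (upd c k j) != 0]); last first.
  rewrite negb_exists => /forallP h; rewrite big1 ?eqxx// => j _.
  by have := h j; rewrite negbK => /eqP.
move=> /existsP[j /IH[x [Fx xD xc]]] _; exists x; split => // i; rewrite inE.
  case/orP => [/eqP->|/xD//]; case: (boolP (k \in D)) => [/xD//|kD].
  by rewrite xc ?inE// /upd eqxx.
by rewrite inE negb_or => /andP[ik iD]; rewrite xc ?inE// /upd (negbTE ik).
Qed.

End GridLabelling.

Lemma grid_label_change (I : finType) (n : nat) (a : I -> (I -> nat) -> bool) :
  (forall i x, x i = 0%N -> a i x = false) ->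
  (forall i x, x i = n -> a i x = true) ->
  exists c : I -> nat, (forall i, (c i < n)%N) /\
    forall i b, exists2 x, (forall j, (c j <= x j <= (c j).+1)%N) & a i x = b.
Proof.
move=> a0 an; have := box_sum_cup a0 an (fun=> 0%N) (enum_uniq I).
move=> e; have : box_sum n (enum I) (cup a (enum I) (enum I)) (fun=> 0%N) != 0.
  by rewrite e oner_eq0.
move=> /box_sum_neq0[c [/cup_neq0 h cn _]]; exists c; split=> [i|i b].
  by apply: cn; rewrite mem_enum.
have [|x xc <-] := h i b; first by rewrite mem_enum.
by exists x => // j; have := xc j; rewrite mem_enum addn1.
Qed.

(** * Brouwer's fixed point theorem *)

Section MatrixLimits.
Variables (R : realType) (m n : nat).

Lemma mx_norm_leP (x : 'M[R]_(m, n)) r : 0 <= r ->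
  (`|x| <= r) <-> (forall i j, `|x i j| <= r).
Proof.
move=> r0; rewrite [`|x|]/Num.norm /= mx_normrE; split.
  by move=> /bigmax_leP[_ h] i j; exact: (h (i, j)).
by move=> h; apply/bigmax_leP; split => // -[i j] _; exact: h.
Qed.

Lemma mx_entry_norm (x : 'M[R]_(m, n)) i j : `|x i j| <= `|x|.
Proof. by have /(mx_norm_leP x (normr_ge0 _)) := lexx `|x|; apply. Qed.

Lemma cvg_mx (T : Type) (F : set_system T) (FF : Filter F)
    (g : T -> 'M[R]_(m, n)) (l : 'M[R]_(m, n)) :
  (forall i j, g x i j @[x --> F] --> l i j) -> g @ F --> l.
Proof.
move=> gl; apply/cvgrPdist_le => e e0.
have : \forall x \near F, forall ij : 'I_m * 'I_n, `|l ij.1 ij.2 - g x ij.1 ij.2| <= e.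
  apply: filter_forall => -[i j] /=.
  by move: (gl i j) => /cvgrPdist_le; apply.
apply: filterS => x h; apply/mx_norm_leP; first exact: ltW.
by move=> i j; rewrite !mxE; exact: (h (i, j)).
Qed.

End MatrixLimits.

(** Compactness gives the image ultrafilter a cluster point, and an ultrafilter converges to each of
    its cluster points. *)
Lemma ultra_cvg_segment (R : realType) (U : set_system nat) (UU : UltraFilter U)
    (u : nat -> R) (a b : R) :
  (forall k, a <= u k <= b) -> exists l : R, u @ U --> l.
Proof.
move=> uab; have [|l [_ lcl]] := @segment_compact R a b (u @ U) _.
  by apply: (@filterE _ U) => k; rewrite /= in_itv /=.
exists l => A lA; have [//|UnA] := in_ultra_setVsetC (u @^-1` A) UU.
by have [x [nAx Ax]] := lcl (~` A) A UnA lA.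
Qed.

Lemma ultra_cvg_mx (R : realType) (U : set_system nat) (UU : UltraFilter U)
    m n (u : nat -> 'M[R]_(m, n)) (M : R) :
  (forall k, `|u k| <= M) -> exists l : 'M[R]_(m, n), u @ U --> l.
Proof.
move=> uM; have h i j : exists l : R, u k i j @[k --> U] --> l.
  apply: (@ultra_cvg_segment R U UU _ (- M) M) => k.
  by rewrite -ler_norml (le_trans (mx_entry_norm _ _ _)).
have [l hl] := choice (fun ij : 'I_m * 'I_n => h ij.1 ij.2).
exists (\matrix_(i, j) l (i, j)); apply: cvg_mx => i j.
by rewrite mxE; exact: (hl (i, j)).
Qed.

(** Along a free ultrafilter all bounded sequences converge at once, which replaces the extraction
    of subsequences. *)
Lemma nat_ultrafilter : exists U : set_system nat, UltraFilter U /\ \oo `<=` U.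
Proof. exact: ultraFilterLemma. Qed.

Lemma harmonic_ultra_cvg0 (R : realType) (U : set_system nat) (M : R) (UU : UltraFilter U) :
  \oo `<=` U -> M / k.+1%:R @[k --> U] --> 0.
Proof.
move=> oU; have h : M / k.+1%:R @[k --> \oo] --> 0.
  by rewrite -(mulr0 M); apply: cvgM; [exact: cvg_cst|exact: cvg_harmonic].
by move=> A /h; exact: oU.
Qed.

(** The label of a coordinate tells whether [g] does not increase it. Cubes in which every label
    takes both values shrink to a point [x], and the two kinds of vertices give both inequalities
    between [g x] and [x] in each coordinate. *)
Theorem brouwer_fixed_point (R : realType) m n (g : 'M[R]_(m, n) -> 'M[R]_(m, n))
    (p : 'M[R]_(m, n)) (r : R) : 0 < r -> continuous g ->
  (forall x, `|x - p| <= r -> `|g x - p| <= r) -> exists x, `|x - p| <= r /\ g x = x.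
Proof.
move=> r0 gc gr.
pose I := ('I_m * 'I_n)%type.
pose pt (N : nat) (c : I -> nat) : 'M[R]_(m, n) :=
  \matrix_(i, j) (p i j - r + 2 * r * (c (i, j))%:R / N.+1%:R).
(* The values on the two opposite faces are prescribed. There they still agree with the sign of
   [g x - x] in that coordinate, because [g] maps the box into itself. *)
pose a N (ij : I) c := let x := pt N c in
  (c ij != 0%N) && ((c ij == N.+1) || (g x ij.1 ij.2 <= x ij.1 ij.2)).
have a0 N (ij : I) c : c ij = 0%N -> a N ij c = false by rewrite /a => ->.
have an N (ij : I) c : c ij = N.+1 -> a N ij c = true by rewrite /a => ->; rewrite eqxx.
have pt_in N c : (forall ij, (c ij <= N.+1)%N) -> `|pt N c - p| <= r.
  move=> cN; apply/mx_norm_leP; first exact: ltW.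
  move=> i j; rewrite !mxE ler_norml.
  have : 0 <= ((c (i, j))%:R / N.+1%:R : R) <= 1.
    by apply/andP; split; [exact: divr_ge0|rewrite ler_pdivrMr ?ltr0n// mul1r ler_nat].
  by rewrite -mulrA; move: (_ / _) => q /andP[q0 q1]; apply/andP; split; nra.
have [c hc] := choice (fun N => @grid_label_change I N.+1 (a N) (a0 N) (an N)).
have [U [UU oU]] := nat_ultrafilter.
have ptc N : `|pt N (c N) - p| <= r by apply: pt_in => ij; exact/ltnW/(hc N).1.
have [x xU] : exists x : 'M[R]_(m, n), pt k (c k) @[k --> U] --> x.
  apply: (@ultra_cvg_mx R U UU m n _ (r + `|p|)) => k.
  by rewrite -[X in `|X|](subrK p) (le_trans (ler_normD _ _))// lerD.
have xr : `|x - p| <= r.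
  have : `|pt k (c k) - p| @[k --> U] --> `|x - p|.
    by apply: cvg_norm; apply: cvgB => //; exact: cvg_cst.
  by move=> /cvgr_to_le; apply; exact: filterE.
exists x; split => //; apply/matrixP => i j.
have hq (Nb : nat * bool) : exists x, (forall ij, (c Nb.1 ij <= x ij <= (c Nb.1 ij).+1)%N) /\
    a Nb.1 (i, j) x = Nb.2.
  by have [y] := (hc Nb.1).2 (i, j) Nb.2; exists y.
have {hq}[q hq] := choice hq.
have qN k b ij : (q (k, b) ij <= k.+1)%N.
  by have /andP[_ /leq_trans] := (hq (k, b)).1 ij; apply; exact: (hc k).1.
(* The chosen vertices lie in the cube at [c k], whose side [2 * r / k.+1%:R] tends to 0, so they
   share the limit [x]. *)
have ptq b : pt k (q (k, b)) @[k --> U] --> x.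
  have e0 : pt k (q (k, b)) - pt k (c k) @[k --> U] --> (0 : 'M[R]_(m, n)).
    apply/norm_cvg0P; apply: (@squeeze_cvgr _ _ _ _ (fun=> 0) (fun k => 2 * r / k.+1%:R)).
    - apply: filterE => k; rewrite normr_ge0; apply/mx_norm_leP.
        by rewrite divr_ge0 ?ler0n// mulr_ge0// ltW.
      move=> i' j'; rewrite !mxE; have /andP[cq qc] := (hq (k, b)).1 (i', j').
      have ring_id (e f v : R) : e + f / v - (e + 2 * r * (c k (i', j'))%:R / v) =
        (f - 2 * r * (c k (i', j'))%:R) / v by ring.
      rewrite ring_id -mulrBr mulrAC normrM ger0_norm; last first.
        by rewrite divr_ge0 ?ler0n// mulr_ge0// ltW.
      rewrite ler_piMr// ?divr_ge0 ?ler0n ?mulr_ge0 ?(ltW r0)//.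
      by rewrite -natrB// ger0_norm ?ler0n// lern1 leq_subLR addn1.
    - exact: cvg_cst.
    - exact: harmonic_ultra_cvg0.
  rewrite -[x](addr0 x) (_ : (fun k => pt k (q (k, b))) =
    (fun k => pt k (c k) + (pt k (q (k, b)) - pt k (c k)))); first exact: cvgD.
  by apply/funext => k; rewrite addrC subrK.
have gq b : g (pt k (q (k, b))) i j @[k --> U] --> g x i j.
  have h := cvg_comp _ _ (ptq b) (gc x).
  exact: (cvg_comp _ _ h (@coord_continuous R m n i j (g x))).
have xq b : pt k (q (k, b)) i j @[k --> U] --> x i j.
  exact: (cvg_comp _ _ (ptq b) (@coord_continuous R m n i j x)).
have gin k b : `|g (pt k (q (k, b))) i j - p i j| <= r.
  have := mx_entry_norm (g (pt k (q (k, b))) - p) i j; rewrite !mxE => /le_trans; apply.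
  by apply: gr; apply: pt_in => ij; exact: qN.
apply/eqP; rewrite eq_le; apply/andP; split.
  apply: (ler_cvg_to (gq true) (xq true)); apply: filterE => k.
  have [_ /andP[_ /orP[/eqP e|//]]] := hq (k, true).
  rewrite [leRHS]mxE e -mulrA divff ?pnatr_eq0// mulr1.
  by move: (gin k true); rewrite ler_norml => /andP[_]; lra.
apply: (ler_cvg_to (xq false) (gq false)); apply: filterE => k.
have [_ /negbT] := hq (k, false); rewrite negb_and negbK => /orP[/eqP e|].
  rewrite [leLHS]mxE e mulr0 mul0r addr0.
  by move: (gin k false); rewrite ler_norml => /andP[+ _]; lra.
by rewrite negb_or => /andP[_]; rewrite -ltNge => /ltW.
Qed.

(** * Bounding functions *)

Section BoundingFunctions.
Variables (R : realType) (N : nat).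
Implicit Types (x y u : 'rV[R]_N) (G : set 'rV[R]_N).

Lemma dotvDl x y u : dotv (x + y) u = dotv x u + dotv y u.
Proof. by rewrite /dotv -big_split; apply: eq_bigr => i _; rewrite mxE mulrDl. Qed.

Lemma dotvZl a x u : dotv (a *: x) u = a * dotv x u.
Proof. by rewrite /dotv mulr_sumr; apply: eq_bigr => i _; rewrite mxE mulrA. Qed.

Lemma dotvBl x y u : dotv (x - y) u = dotv x u - dotv y u.
Proof. by rewrite dotvDl -scaleN1r dotvZl mulN1r. Qed.

Lemma dotvv_ge0 x : 0 <= dotv x x.
Proof. by apply: sumr_ge0 => i _; rewrite -expr2 sqr_ge0. Qed.

Lemma sqr_enorm x : enorm x ^+ 2 = dotv x x.
Proof. by rewrite sqr_sqrtr // dotvv_ge0. Qed.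

Lemma enormZ a x : enorm (a *: x) = `|a| * enorm x.
Proof.
rewrite /enorm dotvZl (_ : dotv x (a *: x) = a * dotv x x); last first.
  by rewrite /dotv mulr_sumr; apply: eq_bigr => i _; rewrite mxE mulrCA.
by rewrite mulrA -expr2 sqrtrM ?sqr_ge0// sqrtr_sqr.
Qed.

Lemma cvg_enorm (T : Type) (F : set_system T) (FF : Filter F) (g : T -> 'rV[R]_N) x :
  g @ F --> x -> enorm (g t) @[t --> F] --> enorm x.
Proof.
move=> gx; have h i : g t 0 i @[t --> F] --> x 0 i.
  exact: (cvg_comp _ _ gx (@coord_continuous R 1 N 0 i x)).
have : dotv (g t) (g t) @[t --> F] --> dotv x x.
  apply: (@cvg_big R 'I_N +%R 0 predT) => [z|i _]; last by apply: cvgM; exact: h.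
  by apply: cvgD; [exact: cvg_fst|exact: cvg_snd].
by move=> /cvg_comp; apply; exact: sqrt_continuous.
Qed.

Lemma eball_open u r : open (eball u r).
Proof.
rewrite openE => x xu.
have c : enorm (y - u) @[y --> nbhs x] --> enorm (x - u).
  apply: (@cvg_enorm _ _ (nbhs_filter x)).
  exact: (cvgB (FF := nbhs_filter x) (fun A h => h) (cvg_cst u (FF := nbhs_filter x))).
exact: (cvgr_lt (FF := nbhs_filter x) _ c _ xu).
Qed.

Lemma differential_gradient (W : 'rV[R]_N -> R) u x :
  differentiable W u -> 'd W u x = dotv x (gradient W u).
Proof.
move=> dW; rewrite [in LHS](row_sum_delta x) linear_sum; apply: eq_bigr => i _.
by rewrite linearZ mxE deriveE.
Qed.

(** A positive value at a point of the closure would persist at nearby points of [G]. *)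
Lemma bounding_function_le0 G V u r x : open G -> C1_on (eball u r) (V u : 'rV[R]_N -> R) ->
  G `&` eball u r `<=` [set x | eball u r x /\ V u x < 0] ->
  closure G x -> eball u r x -> V u x <= 0.
Proof.
move=> Go [dV _] GV Gx ux; rewrite leNgt; apply/negP => Vx.
have cV : {for x, continuous (V u)} by apply: differentiable_continuous; exact: dV.
have [y [Gy [uy Vy]]] : G `&` (eball u r `&` [set y | 0 < V u y]) !=set0.
  apply: Gx; apply: filterI; first by apply: open_nbhs_nbhs; split => //; exact: eball_open.
  exact: (cvgr_gt _ cV).
by have [_] := GV y (conj Gy uy); rewrite ltNge (ltW Vy).
Qed.

(** To the left of [t] one has [V u (w s) <= 0 = V u (w t)], so the left difference quotients of
    [V u] along [w] are nonnegative. *)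
Lemma left_derivative_gradient_ge0 G V u (w : R -> 'rV[R]_N) t L : open G ->
  bounding_functions G V -> frontier G u -> w t = u ->
  (s - t)^-1 *: (w s - w t) @[s --> t^'-] --> L ->
  (\forall s \near t^'-, closure G (w s)) -> 0 <= dotv L (gradient (V u) u).
Proof.
move=> Go bV Fu wt wL wG; have [r [r0 C1 Vu0 GV]] := bV u Fu.
have uu : eball u r u.
  by rewrite /eball /= subrr /enorm /dotv big1 ?sqrtr0// => i _; rewrite mxE mul0r.
have dV : differentiable (V u) u by exact: C1.1.
rewrite -differential_gradient //.
have dc : 'd (V u) u ((s - t)^-1 *: (w s - w t)) @[s --> t^'-] --> 'd (V u) u L.
  apply: (cvg_comp _ _ wL); exact: (diff_continuous dV).
have w0 : w s - w t @[s --> t^'-] --> (0 : 'rV[R]_N).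
  have s0 : s - t @[s --> t^'-] --> (0 : R).
    rewrite -(subrr t); apply: cvgB; last exact: cvg_cst.
    exact: cvg_within.
  have : (s - t) *: ((s - t)^-1 *: (w s - w t)) @[s --> t^'-] --> (0 : R) *: L.
    exact: cvgZ.
  rewrite scale0r => h; apply: (cvg_trans _ h); apply: near_eq_cvg.
  near=> s; rewrite scalerA divff ?scale1r// subr_eq0.
  by rewrite lt_eqF.
suff h : forall e, 0 < e -> - (e * `|L|) <= 'd (V u) u L.
  rewrite leNgt; apply/negP => dL0; have L0 : 0 < `|L| + 1 by rewrite ltr_wpDl.
  (* With this choice [e * |L|] is less than half of [- 'd (V u) u L]. *)
  have := h (- 'd (V u) u L / (2 * (`|L| + 1))).
  rewrite divr_gt0 ?mulr_gt0 ?oppr_gt0// => /(_ isT).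
  rewrite leNgt => /negP; apply; rewrite ltrNr mulrAC ltr_pdivrMr ?mulr_gt0//.
  by have := normr_ge0 L; nra.
move=> e e0.
have cq : - (e * `|(s - t)^-1 *: (w s - w t)|) @[s --> t^'-] --> - (e * `|L|).
  by apply: cvgN; apply: cvgM; [exact: cvg_cst|exact: cvg_norm].
apply: (ler_cvg_to cq dc).
have /eqaddoP/(_ e e0) := diff_locally dV; rewrite /= => ho.
have {}ho := w0 _ ho.
have wu : \forall s \near t^'-, eball u r (w s).
  have : w s @[s --> t^'-] --> u.
    rewrite -wt -[w t]add0r; apply: (cvg_trans _ (cvgD w0 (cvg_cst (w t)))).
    by apply: near_eq_cvg; apply: filterE => s; rewrite subrK.
  by move=> /(_ (eball u r)); apply; apply: open_nbhs_nbhs; split => //; exact: eball_open.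
near=> s.
have st : s - t < 0 by rewrite subr_lt0.
have Vs : V u (w s) <= 0.
  by apply: (bounding_function_le0 Go C1 GV); near: s.
have : `|V u (w s) - (V u u + 'd (V u) u (w s - w t))| <= e * `|w s - w t|.
  have : `|(V u \o shift u - (cst (V u u) + 'd (V u) u)) (w s - w t)| <= e * `|w s - w t|.
    by near: s.
  have -> : (V u \o shift u - (cst (V u u) + 'd (V u) u)) (w s - w t) =
    V u (w s - w t + u) - (V u u + 'd (V u) u (w s - w t)) by [].
  by rewrite [in w s - _ + u]wt subrK.
have -> : 'd (V u) u ((s - t)^-1 *: (w s - w t)) = (s - t)^-1 * 'd (V u) u (w s - w t).
  by rewrite linearZ.
rewrite Vu0 add0r normrZ normfV (ltr0_norm st).
rewrite ler_norml => /andP[h _].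
have -> : e * ((- (s - t))^-1 * `|w s - w t|) = (s - t)^-1 * - (e * `|w s - w t|).
  by rewrite invrN; ring.
(* Multiplication by the negative number [(s - t)^-1] reverses the inequality. *)
by rewrite -mulrN ler_nM2l ?invr_lt0// opprK; lra.
Unshelve. all: by end_near. Qed.

(** For every [q] in the ball, the segment from [q] reaches [u] through [G], so the previous lemma
    gives [0 <= dotv (u - q) g]. Moving [q] from [p] along [g] up to the boundary of the ball gains
    the positive amount [delta * enorm g]. *)
Lemma star_shaped_gradient_gt0 G V u p delta eta : open G -> bounding_functions G V ->
  (forall q, eclosed_ball p delta q -> strictly_star_shaped G q) ->
  frontier G u -> 0 < delta -> 0 < eta -> eta <= enorm (gradient (V u) u) ->
  0 < dotv (u - p) (gradient (V u) u).
Proof.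
move=> Go bV star Fu d0 eta0; set g := gradient _ _ => eg.
have g0 : 0 < enorm g by exact: lt_le_trans eg.
(* The point of the ball furthest in the direction of the gradient. *)
pose q := p + (delta / enorm g) *: g.
have qp : eclosed_ball p delta q.
  rewrite /eclosed_ball /= /q addrC addKr enormZ ger0_norm ?divfK ?gt_eqF//.
  by rewrite divr_ge0// ltW.
have [_ /(_ u Fu) sq] := star q qp.
have : 0 <= dotv (u - q) g.
  apply: (@left_derivative_gradient_ge0 G V u (fun s => q + s *: (u - q)) 1) => //.
  - by rewrite scale1r addrC subrK.
  - have h : (u - q) @[s --> (1 : R)^'-] --> u - q by exact: cvg_cst.
    apply: (cvg_trans _ h); apply: near_eq_cvg; near=> s.
    have -> : q + s *: (u - q) - (q + 1 *: (u - q)) = (s - 1) *: (u - q).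
      by apply/rowP => i; rewrite !mxE; ring.
    rewrite scalerA mulVf ?scale1r//.
    by rewrite subr_eq0 lt_eqF.
  - near=> s; apply: subset_closure; apply: sq; exists s => //=; apply/andP; split => //.
    by near: s; exact: nbhs_left_ge.
have -> : u - q = (u - p) - (delta / enorm g) *: g by rewrite /q opprD addrA.
rewrite [dotv (_ - _ *: _) _]dotvBl dotvZl -sqr_enorm expr2 mulrA divfK ?gt_eqF//.
by move=> h; apply: lt_le_trans (_ : delta * enorm g <= _); [exact: mulr_gt0|lra].
Unshelve. all: by end_near. Qed.
End BoundingFunctions.

(** * Cyclic Euler schemes *)

Section TruncatedDistance.
Variables (R : realType) (W : normedModType R) (G : set W).
Implicit Types x y z : W.

Let dists x := [set r : R | r = 1 \/ exists2 z, ~ G z & r = `|x - z|].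

(* The cap at 1 keeps the infimum meaningful when [~` G] is empty. *)
Definition codist x : R := inf (dists x).

Let dists_neq0 x : dists x !=set0. Proof. by exists 1; left. Qed.

Let dists_lb x : lbound (dists x) 0.
Proof. by move=> r [->|[z _ ->]]. Qed.

Let codist_le x r : dists x r -> codist x <= r.
Proof. by apply: ge_inf; exists 0; exact: dists_lb. Qed.

Lemma codist_ge0 x : 0 <= codist x.
Proof. by apply: lb_le_inf => //; exact: dists_lb. Qed.

Lemma codist_lipschitz x y : codist x <= codist y + `|x - y|.
Proof.
rewrite -lerBlDr; apply: lb_le_inf => // r [->|[z Gz ->]]; rewrite lerBlDr.
  by apply: (@le_trans _ _ 1); [apply: codist_le; left|rewrite lerDl].
apply: (@le_trans _ _ `|x - z|); first by apply: codist_le; right; exists z.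
by have := ler_distD y x z; lra.
Qed.

Lemma codist_continuous : continuous codist.
Proof.
move=> x; apply/cvgrPdist_le => e e0.
have : \forall y \near x, `|x - y| <= e by apply: cvgr_dist_le.
apply: filterS => y xy; rewrite ler_norml; apply/andP; split.
  by have := codist_lipschitz y x; rewrite distrC; lra.
by have := codist_lipschitz x y; lra.
Qed.

Lemma codist_notin x : ~ G x -> codist x = 0.
Proof.
move=> Gx; apply/eqP; rewrite eq_le codist_ge0 andbT; apply: codist_le.
by right; exists x; rewrite ?subrr ?normr0.
Qed.

Lemma codist_gt0 x : open G -> G x -> 0 < codist x.
Proof.
move=> Go Gx; have /nbhs_ballP[e /= e0 eG] := open_nbhs_nbhs (conj Go Gx).
apply: (@lt_le_trans _ _ (Num.min 1 e)); first by rewrite lt_min ltr01.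
apply: lb_le_inf => // r [->|[z Gz ->]]; first by rewrite ge_min lexx.
rewrite ge_min; apply/orP; right; rewrite leNgt; apply/negP => xz.
by apply: Gz; apply: eG; rewrite -ball_normE.
Qed.

Lemma codist_lt x e : e <= 1 -> codist x < e -> exists2 z, ~ G z & `|x - z| < e.
Proof.
move=> e1 xe; have [r] := inf_lt (dists_neq0 x) xe.
by move=> [->|[z Gz ->]] re; [move: re; rewrite ltNge e1|exists z].
Qed.

End TruncatedDistance.

(** * Existence of cyclic polygons by Brouwer's theorem *)

Section CyclicHomotopy.
Variables (R : realType) (N n : nat) (G : set 'rV[R]_N) (p : 'rV[R]_N).
Variables (F : 'I_n.+1 -> 'rV[R]_N -> 'rV[R]_N) (M : R).

Lemma cvg_row (T : Type) (Q : set_system T) (FQ : Filter Q)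
    (g : T -> 'M[R]_(n.+1, N)) (x : 'M[R]_(n.+1, N)) k :
  g @ Q --> x -> row k (g t) @[t --> Q] --> row k x.
Proof.
move=> gx; apply: cvg_mx => i j; rewrite mxE.
under eq_cvg do rewrite mxE.
exact: (cvg_comp _ _ gx (@coord_continuous R n.+1 N k j x)).
Qed.

(** The nodes are the rows of a fixed point of [Phi], and [l] is the value of [mu] there. It is
    nonzero, so all nodes lie in [G]; if it is less than 1, then so is one of its factors, and the
    corresponding node is close to the complement. *)
Lemma cyclic_homotopy (c : R) : 1 <= c -> open G -> bounded_set G -> G p ->
  (forall k x, closure G x -> {for x, continuous (F k)}) ->
  (forall k x, G x -> `|F k x| <= M) ->
  exists (X : 'I_n.+1 -> 'rV[R]_N) (l : R),
    [/\ 0 <= l <= 1, forall k, G (X k),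
        forall k, X (ordS k) = X k + l *: F k (X k) - ((1 - l) / n.+1%:R) *: (X k - p) &
        l < 1 -> exists k z, ~ G z /\ `|X k - z| < c^-1].
Proof.
move=> c1 Go Gb Gp Fc FM.
have c0 : 0 < c by apply: lt_le_trans c1.
pose m (x : 'M[R]_(n.+1, N)) k : R := Num.min 1 (c * codist G (row k x)).
(* [mu] vanishes as soon as one row leaves [G], so [mu x *: F k (row k x)] is continuous everywhere
   although [F k] is controlled on the closure of [G] only. *)
pose mu x : R := \prod_(k < n.+1) m x k.
have m01 x k : 0 <= m x k <= 1.
  rewrite /m ge_min lexx /= le_min ler01 /= mulr_ge0 ?codist_ge0//.
  by rewrite ltW.
have mu01 x : 0 <= mu x <= 1.
  apply/andP; split; first by apply: prodr_ge0 => k _; case/andP: (m01 x k).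
  by apply: prodr_ile1 => k _; exact: m01.
have mu0 x k : ~ G (row k x) -> mu x = 0.
  by move=> Gk; rewrite /mu (bigD1 k)//= /m codist_notin// mulr0 min_r ?mul0r.
have muG x : mu x != 0 -> forall k, G (row k x).
  by move=> mx k; apply: contrapT => /mu0 /eqP; rewrite (negbTE mx).
have mu_cvg (T : Type) (Q : set_system T) (FQ : Filter Q)
    (g : T -> 'M[R]_(n.+1, N)) (x : 'M[R]_(n.+1, N)) :
    g @ Q --> x -> mu (g t) @[t --> Q] --> mu x.
  move=> gx; apply: (@cvg_big R 'I_n.+1 *%R 1 predT) => [z|k _].
    by apply: cvgM; [exact: cvg_fst|exact: cvg_snd].
  have hc : {for codist G (row k x), continuous (fun r : R => Num.min 1 (c * r))}.
    apply: (@continuous_min R R (cst 1) ( *%R c)); first exact: cst_continuous.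
    exact: mulrl_continuous.
  have h := cvg_comp _ _ (@cvg_row T Q FQ g x k gx) (@codist_continuous R _ G (row k x)).
  exact: (cvg_comp _ _ h hc).
have F_cvg (T : Type) (Q : set_system T) (FQ : Filter Q)
    (g : T -> 'M[R]_(n.+1, N)) (x : 'M[R]_(n.+1, N)) k :
    g @ Q --> x -> mu (g t) *: F k (row k (g t)) @[t --> Q] --> mu x *: F k (row k x).
  move=> gx; have rx := @cvg_row T Q FQ g x k gx.
  have [Gx|Gx] := pselect (closure G (row k x)).
    by apply: cvgZ; [exact: mu_cvg|exact: (cvg_comp _ _ rx (Fc k _ Gx))].
  have Gx' : ~ G (row k x) by move=> /subset_closure.
  rewrite (mu0 x k)// scale0r.
  have nG : \forall t \near Q, (~` closure G) (row k (g t)).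
    apply: rx; apply: open_nbhs_nbhs; split => //.
    by apply: closed_openC; exact: closed_closure.
  have h : (0 : 'rV[R]_N) @[t --> Q] --> (0 : 'rV[R]_N) by exact: cvg_cst.
  apply: (cvg_trans _ h); apply: near_eq_cvg; apply: filterS nG => t Gt.
  by rewrite (mu0 _ k) ?scale0r// => /subset_closure.
pose st k (x : 'M[R]_(n.+1, N)) : 'rV[R]_N := row k x + mu x *: F k (row k x)
   - ((1 - mu x) / n.+1%:R) *: (row k x - p).
(* Row [k] of the image is the Euler step from the cyclic predecessor of [k], so a fixed point is a
   closed polygon. *)
pose Phi x : 'M[R]_(n.+1, N) := \matrix_(k < n.+1) st (ord_pred k) x.
have st_cvg (T : Type) (Q : set_system T) (FQ : Filter Q)
    (g : T -> 'M[R]_(n.+1, N)) (x : 'M[R]_(n.+1, N)) k :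
    g @ Q --> x -> st k (g t) @[t --> Q] --> st k x.
  move=> gx; have rx := @cvg_row T Q FQ g x k gx.
  apply: cvgB; first by apply: cvgD => //; exact: F_cvg.
  apply: cvgZ; last by apply: cvgB => //; exact: cvg_cst.
  apply: cvgM; last exact: cvg_cst.
  by apply: cvgB; [exact: cvg_cst|exact: mu_cvg].
have Phi_cont : continuous Phi.
  move=> x; apply: (@cvg_mx R n.+1 N _ _ (nbhs_filter x)) => i j.
  rewrite (_ : (fun y => Phi y i j) = (fun y => st (ord_pred i) y 0 j)); last first.
    by apply/funext => y; rewrite !mxE.
  have -> : Phi x i j = st (ord_pred i) x 0 j by rewrite !mxE.
  have h := st_cvg _ _ (nbhs_filter x) id x (ord_pred i) (fun A h => h).
  exact: (cvg_comp _ _ h (@coord_continuous R 1 N 0 j _)).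
pose P : 'M[R]_(n.+1, N) := \matrix_(k < n.+1) p.
have P_le (x : 'M[R]_(n.+1, N)) r : 0 <= r ->
    (forall k, `|row k x - p| <= r) <-> `|x - P| <= r.
  move=> r0; split=> h.
    apply/mx_norm_leP => // k j; have := h k => /(mx_norm_leP _ r0)/(_ 0 j).
    by rewrite !mxE.
  move=> k; apply/mx_norm_leP => // i j; move/(mx_norm_leP _ r0)/(_ k j) : h.
  by rewrite (ord1 i) !mxE.
have row_Phi x k : row k (Phi x) = st (ord_pred k) x by rewrite rowK.
have n1 : 0 <= 1 - n.+1%:R^-1 :> R by rewrite subr_ge0 invf_le1 ?ler1n.
have st0 x k : mu x = 0 -> st k x - p = (1 - n.+1%:R^-1) *: (row k x - p).
  move=> mx; rewrite /st mx scale0r addr0 subr0 mul1r scalerBl scale1r.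
  by rewrite addrAC.
have [rho [rho0 Grho]] : exists rho : R, 0 < rho /\ forall x, G x -> `|x - p| <= rho.
  have [B /= B0 GB] := ex_strict_bound_gt0 Gb.
  exists (B + `|p|); split; first by rewrite ltr_wpDr.
  by move=> x /GB xB; rewrite (le_trans (ler_normB _ _))// lerD2r ltW.
have M0 : 0 <= M by apply: le_trans (FM ord0 p Gp).
have nV : 0 <= n.+1%:R^-1 :> R by rewrite invr_ge0.
(* This ball is invariant: if [mu x = 0], each step contracts towards [p]; otherwise all rows are in
   [G], within [rho] of [p], and a step adds at most [M]. *)
have [|||x [_ xfix]] := @brouwer_fixed_point R n.+1 N Phi P (2 * rho + M).
- by lra.
- exact: Phi_cont.
- move=> x /P_le => /(_ ltac:(lra)) xr; apply/P_le; first by lra.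
  move=> k; rewrite row_Phi; move: (ord_pred k) => {}k.
  have [mx|/muG Gx] := eqVneq (mu x) 0.
    rewrite st0// normrZ ger0_norm// (le_trans _ (xr k))// ler_piMl//.
  have -> : st k x - p = (1 - (1 - mu x) / n.+1%:R) *: (row k x - p) + mu x *: F k (row k x).
    by rewrite /st; apply/rowP => i; rewrite !mxE; ring.
  have /andP[mx0 mx1] := mu01 x.
  have c01 : 0 <= 1 - (1 - mu x) / n.+1%:R <= 1.
    rewrite lerBlDr lerDl mulr_ge0 ?subr_ge0// andbT ler_pdivrMr ?ltr0n// mul1r.
    by apply: (@le_trans _ _ 1); [lra|rewrite ler1n].
  move: c01 => /andP[c01 c11]; rewrite (le_trans (ler_normD _ _))// !normrZ !ger0_norm//.
  have h1 : (1 - (1 - mu x) / n.+1%:R) * `|row k x - p| <= `|row k x - p| by exact: ler_piMl.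
  have h2 : mu x * `|F k (row k x)| <= `|F k (row k x)| by exact: ler_piMl.
  rewrite (le_trans (lerD h1 h2))//; have := Grho _ (Gx k); have := FM k _ (Gx k).
  by move: rho0; clear; lra.
have rowx k : row (ordS k) x = st k x by rewrite -[in LHS]xfix row_Phi ordSK.
(* If [mu x = 0], going once around the cycle contracts all rows towards [p] by a factor less than
   1, so they all equal [p]; but [mu] is positive there. *)
have mux : mu x != 0.
  apply/eqP => mx.
  have xp : `|x - P| <= (1 - n.+1%:R^-1) * `|x - P|.
    apply/P_le => [|k]; first by rewrite mulr_ge0.
    rewrite -[k]ord_predK rowx st0// normrZ ger0_norm// ler_wpM2l//.
    by move: (ord_pred k); apply/P_le.
  have {}xp : `|x - P| <= 0.
    have n0 : 0 < n.+1%:R^-1 :> R by rewrite invr_gt0 ltr0n.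
    by move: xp; rewrite mulrBl mul1r lerDl oppr_ge0 pmulr_rle0.
  have rp k : row k x = p.
    apply/eqP; rewrite -subr_eq0 -normr_le0.
    by move: k; apply/P_le.
  have : 0 < mu x.
    by apply: prodr_gt0 => k _; rewrite /m rp lt_min ltr01 mulr_gt0// codist_gt0.
  by rewrite mx ltxx.
exists (fun k => row k x), (mu x); split => //.
- exact: muG.
- move=> l1; have [k mk] : exists k, m x k < 1.
    apply: contrapT => /forallNP h; suff : mu x = 1 by move=> e; rewrite e ltxx in l1.
    apply: big1 => k _; apply/eqP; rewrite eq_le; apply/andP; split.
      by case/andP: (m01 x k).
    by rewrite leNgt; apply/negP/h.
  exists k; have : codist G (row k x) < c^-1.
    by move: mk; rewrite gt_min ltxx /= mulrC -ltr_pdivlMr// div1r.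
  by move=> /codist_lt; rewrite invf_le1// => /(_ c1)[z Gz xz]; exists z.
Qed.
End CyclicHomotopy.

(** * Passage to the limit *)

Lemma cvg_pair_point (X Y : topologicalType) (T : Type) (Q : set_system T) (FQ : Filter Q)
    (a : T -> X) (b : T -> Y) (x : X) (y : Y) :
  a @ Q --> x -> b @ Q --> y -> (a t, b t) @[t --> Q] --> (x, y).
Proof. by move=> ax b_y; exact: (cvg_pair ax b_y). Qed.

Lemma within_continuous_cvg (X Y : topologicalType) (A : set X) (g : X -> Y)
    (T : Type) (Q : set_system T) (FQ : Filter Q) (a : T -> X) (z : X) :
  {within A, continuous g} -> a @ Q --> z -> A z -> (\forall t \near Q, A (a t)) ->
  g (a t) @[t --> Q] --> g z.
Proof.
move=> /subspace_continuousP gA az Az Aa B /(gA z Az) gB.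
by have := az _ gB; rewrite /= => h; apply: filterS2 Aa h => t At; apply.
Qed.

(** Used twice: with [L = 0] for the Lipschitz bound on the nodes, and with [L] a value of the field
    for the differentiability of the limit. *)
Lemma increments_approx (R : realType) (W : normedModType R) (v : nat -> W) (h e : R) (L : W)
    (j k : nat) : (j <= k)%N ->
  (forall i, (j <= i < k)%N -> `|v i.+1 - v i - h *: L| <= h * e) ->
  `|v k - v j - ((k - j)%:R * h) *: L| <= (k - j)%:R * h * e.
Proof.
elim: k => [|k IH] jk.
  by move: jk; rewrite leqn0 => /eqP -> _; rewrite subrr !mul0r scale0r subr0 normr0.
move: jk; rewrite leq_eqVlt => /orP[/eqP -> _|].
  by rewrite subnn subrr !mul0r scale0r subr0 normr0.
rewrite ltnS => jk vi; rewrite subSn// -natr1.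
have -> : v k.+1 - v j - (((k - j)%:R + 1) * h) *: L =
    (v k - v j - ((k - j)%:R * h) *: L) + (v k.+1 - v k - h *: L).
  rewrite mulrDl mul1r scalerDl opprD [RHS]addrACA; congr (_ + _).
  by rewrite [RHS]addrC subrKA.
rewrite (le_trans (ler_normD _ _))// !mulrDl mul1r lerD//.
  by apply: IH => // i /andP[ji ik]; apply: vi; rewrite ji (ltn_trans ik).
by apply: vi; rewrite jk leqnn.
Qed.

Section Homotopy.
Variables (R : realType) (N : nat) (T : R) (Omega : set 'rV[R]_N).
Variables (f : R -> 'rV[R]_N -> 'rV[R]_N) (G : set 'rV[R]_N) (p : 'rV[R]_N).
Hypotheses (T_gt0 : 0 < T)
  (f_cont : {within `[0, T] `*` Omega, continuous (fun z : R * 'rV[R]_N => f z.1 z.2)})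
  (G_open : open G) (G_bounded : bounded_set G) (G_Omega : closure G `<=` Omega) (Gp : G p).
Hypothesis Omega_open : open Omega.

Definition homotopy_field (l t : R) (x : 'rV[R]_N) : 'rV[R]_N :=
  l *: f t x - ((1 - l) / T) *: (x - p).

Lemma closure_bounded : exists B : R, 0 < B /\ forall x, closure G x -> `|x| <= B.
Proof.
have [B /= B0 GB] := ex_strict_bound_gt0 G_bounded.
exists B; split => // x Gx; rewrite leNgt; apply/negP => xB.
have c : `|y| @[y --> nbhs x] --> `|x|.
  exact: (cvg_norm (FF := nbhs_filter x) (fun A h => h)).
have [y [Gy yB]] := Gx _ (cvgr_gt (FF := nbhs_filter x) _ c _ xB).
by have := lt_trans yB (GB y Gy); rewrite ltxx.
Qed.

Lemma field_bounded : exists M : R, 0 <= M /\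
  forall t x, 0 <= t <= T -> closure G x -> `|f t x| <= M.
Proof.
have cG : compact (closure G).
  apply: bounded_closed_compact; last exact: closed_closure.
  have [B [_ GB]] := closure_bounded; exists B; split; first exact: num_real.
  by move=> M BM x Gx; exact: le_trans (GB x Gx) (ltW BM).
have cK : compact (`[0, T] `*` closure G) by apply: compact_setX => //; exact: segment_compact.
have cf : {within `[0, T] `*` closure G, continuous (fun z : R * 'rV[R]_N => f z.1 z.2)}.
  by apply: continuous_subspaceW f_cont => -[t x] [? /G_Omega].
have [M [_ hM]] := compact_bounded (continuous_compact cf cK).
exists (Num.max 0 (M + 1)); split; first by rewrite le_max lexx.
move=> t x tT Gx; rewrite le_max; apply/orP; right; apply: hM; first by rewrite ltrDl.
by exists (t, x) => //; split => //=; rewrite in_itv.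
Qed.

Lemma homotopy_field_bounded : exists M : R, 0 <= M /\
  forall l t x, 0 <= l <= 1 -> 0 <= t <= T -> closure G x -> `|homotopy_field l t x| <= M.
Proof.
have [M [M0 hM]] := field_bounded; have [B [B0 hB]] := closure_bounded.
exists (M + (B + `|p|) / T); split.
  by rewrite addr_ge0// divr_ge0 ?addr_ge0// ltW.
move=> l t x /andP[l0 l1] tT Gx; rewrite (le_trans (ler_normB _ _))// !normrZ.
rewrite (ger0_norm l0) ger0_norm ?divr_ge0 ?subr_ge0 ?(ltW T_gt0)//.
have h1 : l * `|f t x| <= M by rewrite (le_trans _ (hM t x tT Gx))// ler_piMl.
have h2 : `|x - p| <= B + `|p| by rewrite (le_trans (ler_normB _ _))// lerD2r hB.
have h3 : (1 - l) * `|x - p| <= `|x - p| by rewrite ler_piMl// gerBl.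
apply: lerD => //; rewrite mulrAC; rewrite ger0_norm ?invr_ge0 ?(ltW T_gt0)//.
apply: ler_wpM2r; first by rewrite invr_ge0 ltW.
exact: le_trans h3 h2.
Qed.

(** This is [cyclic_homotopy] for the maps [h *: f (k%:R * h)] and [c = n.+1%:R]; the pull towards
    [p] has the right size because [h / T = 1 / n.+1%:R]. *)
Lemma discrete_solution (n : nat) : exists (x : nat -> 'rV[R]_N) (l : R),
  let h := T / n.+1%:R in
  [/\ 0 <= l <= 1, forall k, G (x k), x n.+1 = x 0%N,
      forall k, (k <= n)%N -> x k.+1 = x k + h *: homotopy_field l (k%:R * h) (x k) &
      l < 1 -> exists k z, [/\ (k <= n)%N, ~ G z & `|x k - z| < n.+1%:R^-1]].
Proof.
have [M [M0 hM]] := field_bounded.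
set h := T / n.+1%:R; have h0 : 0 < h by rewrite divr_gt0.
have kT (k : nat) : (k <= n)%N -> 0 <= k%:R * h <= T.
  move=> kn; rewrite mulr_ge0 ?(ltW h0)//= mulrA ler_pdivrMr// mulrC ler_pM2l//.
  by rewrite ler_nat ltnW.
have n1 : 1 <= n.+1%:R :> R by rewrite ler1n.
pose F (k : 'I_n.+1) x := h *: f (k%:R * h) x.
have Fc k x : closure G x -> {for x, continuous (F k)}.
  move=> Gx; have kh := kT _ (leq_ord k).
  have F_cvg (U : Type) (Q : set_system U) (FQ : Filter Q) (g : U -> 'rV[R]_N) :
      g @ Q --> x -> F k (g t) @[t --> Q] --> F k x.
    move=> gx; apply: cvgZ; first exact: cvg_cst.
    apply: (@within_continuous_cvg _ _ _ _ _ Q FQ (fun t => (k%:R * h, g t))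
      (k%:R * h, x) f_cont).
    - by apply: cvg_pair_point => //; exact: cvg_cst.
    - by split => /=; [rewrite in_itv|exact: G_Omega].
    - have Ox : nbhs x Omega by apply: open_nbhs_nbhs; split => //; exact: G_Omega.
      have gO : \forall t \near Q, Omega (g t) by exact: gx.
      by apply: filterS gO => t Ot; split => //=; rewrite in_itv.
  exact: (F_cvg _ _ (nbhs_filter x) id (fun A hA => hA)).
have FM k x : G x -> `|F k x| <= h * M.
  move=> Gx; rewrite normrZ (ger0_norm (ltW h0)) ler_wpM2l ?(ltW h0)//.
  by apply: hM; [exact: kT (leq_ord k)|exact: subset_closure].
have [X [l [l01 GX XS Xl]]] := cyclic_homotopy n1 G_open G_bounded Gp Fc FM.
(* Indices are read modulo [n.+1], so that node [n.+1] is node 0. *)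
exists (fun k => X (inord (k %% n.+1))), l; split => //.
- by rewrite modnn mod0n.
- move=> k kn; have -> : (inord (k.+1 %% n.+1) : 'I_n.+1) = ordS (inord (k %% n.+1)).
    apply/val_inj => /=; rewrite inordK ?ltn_mod// inordK ?ltn_mod//.
    by rewrite (modn_small (_ : k < n.+1)%N).
  rewrite XS /F inordK ?ltn_mod// modn_small// /homotopy_field.
  set y := f _ _; apply/rowP => i; rewrite !mxE /h; field.
  by rewrite gt_eqF//= addrC natr1 pnatr_eq0.
- move=> /Xl[k [z [Gz kz]]]; exists k, z; split => //; first exact: leq_ord.
  by rewrite modn_small ?inord_val.
Qed.
Lemma homotopy_field_cvg (S : Type) (Q : set_system S) (FQ : Filter Q)
    (l' t' : S -> R) (x' : S -> 'rV[R]_N) (l t : R) (x : 'rV[R]_N) :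
  l' @ Q --> l -> t' @ Q --> t -> x' @ Q --> x -> 0 <= t <= T -> closure G x ->
  (\forall s \near Q, 0 <= t' s <= T /\ closure G (x' s)) ->
  homotopy_field (l' s) (t' s) (x' s) @[s --> Q] --> homotopy_field l t x.
Proof.
move=> ll tt xx tT Gx near_in; apply: cvgB.
  apply: cvgZ => //; apply: (@within_continuous_cvg _ _ _ _ _ Q FQ
    (fun s => (t' s, x' s)) (t, x) f_cont).
  - exact: cvg_pair_point.
  - by split => /=; [rewrite in_itv|exact: G_Omega].
  - apply: filterS near_in => s [ts Gs].
    by split => /=; [rewrite in_itv|exact: G_Omega].
apply: cvgZ; last by apply: cvgB => //; exact: cvg_cst.
by apply: cvgM; [apply: cvgB => //|]; exact: cvg_cst.
Qed.

Lemma homotopy_limit : exists (y : R -> 'rV[R]_N) (l : R),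
  [/\ 0 <= l <= 1, is_solution T (homotopy_field l) y, y 0 = y T,
      forall t, 0 <= t <= T -> closure G (y t) &
      l < 1 -> exists2 t, 0 <= t <= T & frontier G (y t)].
Proof.
have [x hx] := choice discrete_solution; have {hx}[l hl] := choice hx.
have [U [UU oU]] := nat_ultrafilter.
pose h n : R := T / n.+1%:R.
have h0 n : 0 < h n by rewrite divr_gt0.
have hU : h n @[n --> U] --> (0 : R) by exact: harmonic_ultra_cvg0.
have [lam lamU] : exists lam : R, l @ U --> lam.
  by apply: (@ultra_cvg_segment R U UU l 0 1) => n; case: (hl n).
have lam01 : 0 <= lam <= 1.
  apply/andP; split.
    by apply: (cvgr_to_ge lamU); apply: filterE => n; case: (hl n) => /andP[].
  by apply: (cvgr_to_le lamU); apply: filterE => n; case: (hl n) => /andP[].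
(* The index of the last node time not after [t]. It is exactly [n.+1] at [t = T], which carries the
   periodicity of the nodes over to the limit. *)
pose idx n t := Num.truncn (t / h n).
have idx_le n t : 0 <= t -> (idx n t)%:R * h n <= t.
  by move=> t0; rewrite -ler_pdivlMr// truncn_le// divr_ge0// ltW.
have idx_gt n t : 0 <= t -> t < (idx n t)%:R * h n + h n.
  move=> t0; rewrite -[X in _ + X]mul1r -mulrDl -ltr_pdivrMr// natr1.
  by have := truncn_itv (divr_ge0 t0 (ltW (h0 n))) => /andP[].
have hnT n : n.+1%:R * h n = T by rewrite /h mulrC divfK// pnatr_eq0.
have idxN n t : 0 <= t <= T -> (idx n t <= n.+1)%N.
  move=> /andP[t0 tT]; rewrite -(ler_nat R) -(ler_pM2r (h0 n)) hnT.
  exact: le_trans (idx_le n t t0) tT.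
have idxT n : idx n T = n.+1 by rewrite /idx -(hnT n) mulfK ?gt_eqF// natrK.
have idx0 n : idx n 0 = 0%N by rewrite /idx mul0r truncn0.
have idx_mono n s t : s <= t -> (idx n s <= idx n t)%N.
  by move=> st; apply: le_truncn; rewrite ler_pM2r ?invr_gt0.
pose Y n t := x n (idx n t).
have GX n k : closure G (x n k) by apply: subset_closure; case: (hl n).
have kT n k : (k <= n.+1)%N -> 0 <= k%:R * h n <= T.
  by move=> kn; rewrite mulr_ge0 ?(ltW (h0 n))//= -(hnT n) ler_pM2r ?ler_nat.
have step n k : (k <= n)%N ->
    x n k.+1 - x n k = h n *: homotopy_field (l n) (k%:R * h n) (x n k).
  by move=> kn; case: (hl n) => _ _ _ /(_ k kn) -> _; rewrite addrAC subrr add0r.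
have [M [M0 hM]] := homotopy_field_bounded.
have lip n j k : (j <= n.+1)%N -> (k <= n.+1)%N ->
    `|x n j - x n k| <= M * `|j%:R * h n - k%:R * h n|.
  wlog jk : j k / (k <= j)%N.
    move=> H jn kn; have /orP[kj|jk] := leq_total k j; first exact: H.
    by rewrite distrC [X in M * X]distrC; exact: H.
  move=> jn kn; have H := @increments_approx R _ (x n) (h n) M 0 k j jk.
  have -> : x n j - x n k = x n j - x n k - ((j - k)%:R * h n) *: 0.
    by rewrite scaler0 subr0.
  apply: (le_trans (H _)).
    move=> i /andP[ki ij]; have iN : (i <= n)%N by rewrite -ltnS (leq_trans ij).
    rewrite scaler0 subr0 step// normrZ (ger0_norm (ltW (h0 n))) ler_pM2l//.
    by apply: hM => //; [case: (hl n)|apply: kT; exact: leqW].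
  rewrite -mulrBl normrM (ger0_norm (ltW (h0 n))) -natrB// ger0_norm//.
  by rewrite mulrC.
have yex t : exists z : 'rV[R]_N, Y n t @[n --> U] --> z.
  have [B [_ hB]] := closure_bounded.
  by apply: (@ultra_cvg_mx R U UU 1 N _ B) => n; apply: hB; exact: GX.
have [y yU] := choice yex.
have Gy t : closure G (y t).
  apply: (closed_cvg (closure G) _ _ _ (yU t)); first exact: closed_closure.
  by apply: filterE => n; exact: GX.
have idxU t : 0 <= t -> (idx n t)%:R * h n @[n --> U] --> t.
  move=> t0; apply: (@squeeze_cvgr _ _ _ _ (fun n => t - h n) (fun=> t)).
  - apply: filterE => n; rewrite idx_le// andbT.
    by have := idx_gt n t t0; lra.
  - by rewrite -[X in _ --> X]subr0; apply: cvgB => //; exact: cvg_cst.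
  - exact: cvg_cst.
(* Strict differentiability of [y] at [t] only needs the continuity of the field at [(t, y t)]
   and pointwise convergence, so uniform convergence is never required. *)
have strict t e : 0 <= t <= T -> 0 < e -> exists2 eta : R, 0 < eta &
    forall s1 s2, 0 <= s1 -> s1 <= s2 -> s2 <= T -> `|s1 - t| < eta -> `|s2 - t| < eta ->
    `|y s2 - y s1 - (s2 - s1) *: homotopy_field lam t (y t)| <= (s2 - s1) * e.
  move=> tT e0; set L := homotopy_field _ _ _.
  have [r /= r0 hr] : exists2 r : R, 0 < r & forall l' t' x', `|lam - l'| < r ->
      `|t - t'| < r -> `|y t - x'| < r -> 0 <= t' <= T -> closure G x' ->
      `|L - homotopy_field l' t' x'| <= e.
    (* The field is only known to be continuous relative to times in [[0, T]] and points of the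
       closure of [G]. *)
    pose A : set (R * (R * 'rV[R]_N)) := [set z | 0 <= z.2.1 <= T /\ closure G z.2.2].
    pose Q := within A (nbhs (lam, (t, y t))).
    have FQ : Filter Q by exact: within_filter.
    have z0 : z @[z --> Q] --> (lam, (t, y t)) by exact: cvg_within.
    have z1 : z.1 @[z --> Q] --> lam by exact: (cvg_comp _ _ z0 cvg_fst).
    have z2 : z.2 @[z --> Q] --> (t, y t) by exact: (cvg_comp _ _ z0 cvg_snd).
    have z21 : z.2.1 @[z --> Q] --> t by exact: (cvg_comp _ _ z2 cvg_fst).
    have z22 : z.2.2 @[z --> Q] --> y t by exact: (cvg_comp _ _ z2 cvg_snd).
    have AQ : \forall z \near Q, A z by exact: withinT.
    have LQ : homotopy_field z.1 z.2.1 z.2.2 @[z --> Q] --> L.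
      exact: homotopy_field_cvg.
    have /nbhs_ballP[r /= r0 hr] : nbhs (lam, (t, y t))
        [set z | A z -> `|L - homotopy_field z.1 z.2.1 z.2.2| <= e].
      have h1 : \forall z \near Q, `|L - homotopy_field z.1 z.2.1 z.2.2| <= e.
        exact: cvgr_dist_le.
      exact: h1.
    exists r => // l' t' x' ll tt xx tT' Gx'; apply: (hr (l', (t', x'))) => //.
    by split => /=; [|split => /=]; rewrite -ball_normE.
  have t0 : 0 <= t by case/andP: tT.
  (* For mesh less than [eta], the node times between [s1] and [s2] are within [2 * eta] of [t],
     hence within [3 * eta] of the node time of [Y n t]; by [lip] the nodes are then within [r / 2]
     of [Y n t]. *)
  pose eta := r / (4 + 8 * M).
  have eta0 : 0 < eta by rewrite divr_gt0// ltr_wpDr ?mulr_ge0.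
  have [eta_r etaM] : 2 * eta < r /\ M * (3 * eta) < r / 2.
    have : eta * (4 + 8 * M) = r by rewrite /eta divfK// gt_eqF// ltr_wpDr ?mulr_ge0.
    by move=> er; split; nra.
  exists eta => // s1 s2 s10 s12 s2T s1t s2t.
  have s20 : 0 <= s2 by exact: le_trans s12.
  have c1 : `|Y n s2 - Y n s1 - ((idx n s2)%:R * h n - (idx n s1)%:R * h n) *: L| @[n --> U] -->
      `|y s2 - y s1 - (s2 - s1) *: L|.
    apply: cvg_norm; apply: cvgB; first by apply: cvgB.
    by apply: cvgZ; [apply: cvgB; exact: idxU|exact: cvg_cst].
  have c2 : ((idx n s2)%:R * h n - (idx n s1)%:R * h n) * e @[n --> U] --> (s2 - s1) * e.
    by apply: cvgM; [apply: cvgB; exact: idxU|exact: cvg_cst].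
  apply: (ler_cvg_to c1 c2).
  have near_h : \forall n \near U, `|0 - h n| < eta by exact: cvgr_dist_lt.
  have near_y : \forall n \near U, `|y t - Y n t| < r / 2.
    by apply: cvgr_dist_lt => //; rewrite divr_gt0.
  have near_l : \forall n \near U, `|lam - l n| < r by exact: cvgr_dist_lt.
  near=> n.
  have hn : h n < eta.
    have : `|0 - h n| < eta by near: n.
    by rewrite sub0r normrN ger0_norm// ltW.
  have ii := idx_mono n s1 s2 s12.
  have i2 : (idx n s2 <= n.+1)%N by apply: idxN; rewrite s20.
  rewrite -mulrBl -natrB//.
  apply: increments_approx => // i /andP[i1 ilt2].
  have iN : (i <= n)%N by rewrite -ltnS (leq_trans ilt2).
  rewrite step// -scalerBr normrZ (ger0_norm (ltW (h0 n))) ler_pM2l// distrC.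
  have ilo : s1 - h n < i%:R * h n.
    have := idx_gt n s1 s10; have : (idx n s1)%:R * h n <= i%:R * h n :> R.
      by rewrite ler_pM2r// ler_nat.
    by lra.
  have ihi : i%:R * h n <= s2.
    by rewrite (le_trans _ (idx_le n s2 s20))// ler_pM2r// ler_nat ltnW.
  have it : `|t - i%:R * h n| < 2 * eta.
    move: s1t s2t; rewrite !ltr_norml => /andP[? ?] /andP[? ?].
    by apply/andP; split; lra.
  apply: hr => //.
  - by near: n.
  - exact: lt_trans it eta_r.
  - apply: (le_lt_trans (ler_distD (Y n t) _ _)).
    have yt : `|y t - Y n t| < r / 2 by near: n.
    have : `|Y n t - x n i| <= M * (3 * eta).
      apply: (le_trans (lip n _ _ (idxN n t tT) (leqW iN))); apply: ler_wpM2l => //.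
      have := idx_le n t t0; have := idx_gt n t t0; move: it; rewrite ltr_norml ler_norml.
      by move=> /andP[? ?] ? ?; apply/andP; split; lra.
    by lra.
  - by apply: kT; exact: leqW.
exists y, lam; split => //.
- move=> t tT; apply/cvgrPdist_le => e e0.
  have [eta eta0 st] := strict t e tT e0.
  have nt : \forall s \near t, `|t - s| < eta.
    by apply/nbhs_ballP; exists eta => // s; rewrite -ball_normE.
  have : \forall s \near t, s != t -> `[0, T]%classic s ->
      `|homotopy_field lam t (y t) - (s - t)^-1 *: (y s - y t)| <= e.
    apply: filterS nt => s ts sNt; rewrite /= in_itv /= => /andP[s0 sT].
    have /andP[t0 tT'] := tT.
    have st0 : 0 < `|s - t| by rewrite normr_gt0 subr_eq0.
    have -> : homotopy_field lam t (y t) - (s - t)^-1 *: (y s - y t) =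
       - ((s - t)^-1 *: (y s - y t - (s - t) *: homotopy_field lam t (y t))).
      by rewrite [in RHS]scalerBr scalerA mulVf ?subr_eq0// scale1r opprB.
    rewrite normrN normrZ normfV mulrC ler_pdivrMr// mulrC.
    have [st'|ts'] := leP t s.
      rewrite ger0_norm ?subr_ge0//; apply: st => //; first by rewrite subrr normr0.
      by rewrite distrC.
    rewrite ltr0_norm ?subr_lt0// opprB.
    have -> : y s - y t - (s - t) *: homotopy_field lam t (y t) =
       - (y t - y s - (t - s) *: homotopy_field lam t (y t)).
      by rewrite opprB -[s - t]opprB scaleNr opprK addrC opprB addrC.
    rewrite normrN; apply: st => //; first exact: ltW.
      by rewrite distrC.
    by rewrite subrr normr0.
  by [].
- have h1 := yU 0; have h2 := yU T.
  apply: (cvg_unique _ h1); first exact: norm_hausdorff.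
  have -> : Y ^~ 0 = Y ^~ T; last exact: h2.
  by apply/funext => n; rewrite /Y idx0 idxT; case: (hl n).
- move=> lam1.
  (* The pair [(0, 0)] is a placeholder for [l n = 1]; since [lam < 1], this does not occur for
     [U]-almost all [n]. *)
  have kzex n : exists kz : nat * 'rV[R]_N, (kz.1 <= n)%N /\
      (l n < 1 -> ~ G kz.2 /\ `|x n kz.1 - kz.2| < n.+1%:R^-1).
    have [l1|l1] := ltP (l n) 1; last by exists (0%N, 0).
    by have [_ _ _ _ /(_ l1)[k [z [kn Gz xz]]]] := hl n; exists (k, z).
  have [kz hkz] := choice kzex.
  pose tau n := (kz n).1%:R * h n.
  have tauT n : 0 <= tau n <= T by apply: kT; apply: leqW; case: (hkz n).
  have [t tU] := @ultra_cvg_segment R U UU tau 0 T tauT.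
  have tT : 0 <= t <= T.
    apply/andP; split.
      by apply: (cvgr_to_ge tU); apply: filterE => n; case/andP: (tauT n).
    by apply: (cvgr_to_le tU); apply: filterE => n; case/andP: (tauT n).
  exists t => //; split; first exact: Gy.
  have nearl : \forall n \near U, l n < 1 by exact: (cvgr_lt _ lamU).
  (* The outside point is within [1 / n.+1%:R] of a node whose time tends to [t], and by [lip] that
     node is close to [Y n t]. Thus [y t] is a limit of points outside the open set [G]. *)
  have zU : (kz n).2 - Y n t @[n --> U] --> (0 : 'rV[R]_N).
    apply: norm_cvg0.
    have b0 : 1 / n.+1%:R + M * `|tau n - (idx n t)%:R * h n| @[n --> U] --> (0 : R).
      rewrite -[0 in X in _ --> X](addr0 0); apply: cvgD; first exact: harmonic_ultra_cvg0.
      rewrite -(mulr0 M) -(@normr0 R R) -(subrr t); apply: cvgM; first exact: cvg_cst.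
      by apply: cvg_norm; apply: cvgB => //; apply: idxU; case/andP: tT.
    apply: (@squeeze_cvgr _ _ _ _ (fun=> 0) _ _ _ _ _ b0); last exact: cvg_cst.
    apply: filterS nearl => n /(proj2 (hkz n))[_ xz]; rewrite normr_ge0 /=.
    apply: (le_trans (ler_distD (x n (kz n).1) _ _)); apply: lerD.
      by rewrite distrC div1r ltW.
    by apply: lip; [apply: leqW; case: (hkz n)|exact: idxN].
  have zy : (kz n).2 @[n --> U] --> y t.
    rewrite -[y t]add0r (_ : (fun n => (kz n).2) = (fun n => (kz n).2 - Y n t + Y n t)).
      exact: cvgD.
    by apply/funext => n; rewrite subrK.
  have nG : (~` G) (y t).
    apply: (closed_cvg (~` G) _ _ _ zy); first exact: open_closedC.
    by apply: filterS nearl => n /(proj2 (hkz n))[].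
  by move=> /interior_subset.
Unshelve. all: by end_near. Qed.
End Homotopy.

(** * Exclusion of contact with the frontier *)

Theorem theorem3p3 (R : realType) (N : nat) (T : R) (Omega : set 'rV[R]_N)
    (f : R -> 'rV[R]_N -> 'rV[R]_N) (G : set 'rV[R]_N)
    (V : 'rV[R]_N -> 'rV[R]_N -> R) (p : 'rV[R]_N) (delta : R)
    (T_gt0 : 0 < T)
    (Omega_neq0 : Omega !=set0) (Omega_open : open Omega)
    (f_cont : {within `[0, T] `*` Omega,
      continuous (fun z : R * 'rV[R]_N => f z.1 z.2)})
    (G_neq0 : G !=set0) (G_open : open G) (G_bounded : bounded_set G)
    (G_Omega : closure G `<=` Omega)
    (V_bounding : bounding_functions G V) (V_nondeg : non_degenerate G V)
    (delta_gt0 : 0 < delta) (ball_G : eclosed_ball p delta `<=` G)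
    (G_star : forall q, eclosed_ball p delta q -> strictly_star_shaped G q)
    (f_inward : forall u t, frontier G u -> 0 <= t <= T ->
      dotv (f t u) (gradient (V u) u) <= 0) :
  exists y : R -> 'rV[R]_N, periodic_solution_in T f (closure G) y.
Proof.
have Gp : G p.
  apply: ball_G; rewrite /eclosed_ball /= subrr /enorm /dotv big1 ?sqrtr0 ?ltW// => i _.
  by rewrite mxE mul0r.
have [y [l [/andP[l0 l1] ysol yT Gy ltouch]]] :=
  homotopy_limit T_gt0 f_cont G_open G_bounded G_Omega Gp Omega_open.
exists y; split => //.
suff l_eq1 : l = 1.
  move=> t tT; have := ysol t tT.
  by rewrite l_eq1 /homotopy_field scale1r subrr mul0r scale0r subr0.
apply/eqP; rewrite eq_le l1 leNgt; apply/negP => l_lt1.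
have [t [/andP[t0 tT] Fu]] : exists t, 0 < t <= T /\ frontier G (y t).
  have [t /andP[t0 tT] Fu] := ltouch l_lt1.
  move: t0; rewrite le_eqVlt => /orP[/eqP e|t0]; last by exists t; rewrite t0.
  by exists T; rewrite T_gt0 lexx -yT e.
have tT' : 0 <= t <= T by rewrite tT ltW.
have left_in : \forall s \near t^'-, 0 <= s <= T.
  near=> s; apply/andP; split; first by near: s; exact: nbhs_left_ge.
  by apply: le_trans tT.
have dy : (s - t)^-1 *: (y s - y t) @[s --> t^'-] --> homotopy_field T f p l t (y t).
  move=> B /(ysol t tT') hB.
  have {}hB : \forall s \near t, s != t -> `[0, T]%classic s -> B ((s - t)^-1 *: (y s - y t)).
    exact: hB.
  have {}hB : \forall s \near t^'-, s != t -> `[0, T]%classic s -> B ((s - t)^-1 *: (y s - y t)).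
    exact: cvg_within.
  have : \forall s \near t^'-, B ((s - t)^-1 *: (y s - y t)).
    near=> s; have sT : 0 <= s <= T by near: s.
    have st : s != t by rewrite lt_eqF.
    have : s != t -> `[0, T]%classic s -> B ((s - t)^-1 *: (y s - y t)) by near: s.
    by apply => //=; rewrite in_itv.
  by [].
have in_closure : \forall s \near t^'-, closure G (y s) by apply: filterS left_in.
have := left_derivative_gradient_ge0 G_open V_bounding Fu erefl dy in_closure.
have [eta_m [eta_p [eta_gt0 _ nd]]] := V_nondeg; have /andP[ge_eta _] := nd _ Fu.
have outward := star_shaped_gradient_gt0 G_open V_bounding G_star Fu delta_gt0 eta_gt0 ge_eta.
have inward := f_inward _ t Fu tT'.
rewrite /homotopy_field dotvBl !dotvZl leNgt => /negP; apply.
have c_gt0 : 0 < (1 - l) / T by rewrite divr_gt0// subr_gt0.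
by have := mulr_gt0 c_gt0 outward; have := mulr_ge0_le0 l0 inward; lra.
Unshelve. all: by end_near. Qed.
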